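(* Let $X$ be a Banach space and let $(e_n)_n$ be a Schauder basic sequence in $\mathcal{SM}_\xi(X)$, for some $1\le\xi<\omega_1$. Let $E$ be the Banach space generated by $(e_n)_n$ and, for some $k\in\mathbb{N}$, let $(\overline{e}_n)_n\in\mathcal{SM}_k(E)$ be a plegma block generated spreading model of $E$ (of order $k$, with respect to the basis $(e_n)_n$ of $E$). Then $(\overline{e}_n)_n\in\mathcal{SM}_{\xi+k}(X)$.
   Context: $\mathbb{N}=\{1,2,\dots\}$. For $M\subseteq\mathbb{N}$ infinite, $M(k)$ is its $k$-th element; for a finite set $s$, $s(k)$ is its $k$-th element; $t\sqsubseteq s$ means initial segment. For a family $\mathcal{F}$ of finite subsets of $\mathbb{N}$ let $\widehat{\mathcal{F}}=\{t:\exists s\in\mathcal{F},\ t\sqsubseteq s\}$ and $\mathcal{F}\upharpoonright M=\{s\in\mathcal{F}:s\subseteq M\}$. $\mathcal{F}$ is thin if no element is a proper initial segment of another. A family is regular if it is hereditary (closed under subsets), spreading (if $\{n_1<\dots<n_k\}$ is in it, $m_1<\dots<m_k$, $n_i\le m_i$ for all $i$, then $\{m_1,\dots,m_k\}$ is in it) and compact (its characteristic functions form a closed subset of $\{0,1\}^{\mathbb{N}}$). $\mathcal{F}$ is regular thin if it is thin and $\widehat{\mathcal{F}}$ is regular. The order $o(\mathcal{F})$ is the (countable) rank of the well-founded tree $\widehat{\mathcal{F}}$: maximal elements have rank $0$, the rank of $s$ is $\sup\{\mathrm{rank}(t)+1: t\in\widehat{\mathcal{F}},\ s\sqsubset t\}$,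 and $o(\mathcal{F})$ is the rank of $\emptyset$. A tuple $(s_1,\dots,s_l)$ of nonempty finite subsets of $\mathbb{N}$ is plegma if $s_i(k)<s_j(k)$ whenever $i<j$ and $k\le\min(|s_i|,|s_j|)$, and $s_i(k)<s_j(k+1)$ for all $i,j$ and $k\le\min(|s_i|,|s_j|-1)$. An $\mathcal{F}$-subsequence $(x_s)_{s\in\mathcal{F}\upharpoonright M}$ in a Banach space $X$ ($M\subseteq\mathbb{N}$ infinite) is a map $s\mapsto x_s$ from $\mathcal{F}\upharpoonright M$ to $X$. Let $(e_n)_n$ be a Hamel basis of an infinite-dimensional seminormed space with seminorm $\|\cdot\|_*$. $(x_s)_{s\in\mathcal{F}\upharpoonright M}$ generates $(e_n)_n$ as an $\mathcal{F}$-spreading model if there is a null sequence $(\delta_n)_n$ of positive reals such that $\big|\,\|\sum_{j=1}^k a_jx_{s_j}\|-\|\sum_{j=1}^k a_je_j\|_*\big|\le\delta_l$ for all $1\le k\le l$, all plegma $k$-tuples $(s_j)_{j=1}^k$ in $\mathcal{F}\upharpoonright M$ with $s_1(1)\ge M(l)$ and all $a_1,\dots,a_k\in[-1,1]$. For $1\le\xi<\omega_1$, $\mathcal{SM}_\xi(X)$ is the set of all $(e_n)_n$ generated as an $\mathcal{F}$-spreading model by some $\mathcal{F}$-subsequence in $X$ with $\mathcal{F}$ regular thin and $o(\mathcal{F})=\xi$ (the $\xi$-spreading models of $X$). If $\|\cdot\|_*$ is a norm on the span of $(e_n)_n$, the Banach space generated by $(e_n)_n$ is the completion of that span; $(e_n)_n$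 is Schauder basic if it is a Schauder basis of this space. In a Banach space with a Schauder basis, an $\mathcal{F}$-subsequence $(x_s)_{s\in\mathcal{F}\upharpoonright M}$ is plegma block if all $x_s$ are finitely supported and $\mathrm{supp}(x_{s_1})<\mathrm{supp}(x_{s_2})$ (i.e. $\max<\min$) for every plegma pair $(s_1,s_2)$ in $\mathcal{F}\upharpoonright M$. A $\xi$-spreading model is plegma block generated if it is generated by a plegma block $\mathcal{F}$-subsequence with $o(\mathcal{F})=\xi$. *)

(* Defs.v *)
From HB Require Import structures.
From mathcomp Require Import all_boot all_order all_algebra.
From mathcomp Require Import all_classical all_reals all_analysis.

Set Implicit Arguments.
Unset Strict Implicit.
Unset Printing Implicit Defensive.

Import Order.TTheory GRing.Theory Num.Theory.
Import numFieldNormedType.Exports.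

Local Open Scope classical_set_scope.
Local Open Scope ring_scope.

(** * Countable ordinals *)

(* Notations for countable ordinals: [OSup f] denotes the supremum of the
   countable (not necessarily increasing) family [f].  Every ordinal below
   omega_1 has a notation, and every notation denotes such an ordinal.  Distinct
   notations may denote the same ordinal, so that [oeq], and not Leibniz
   equality, is the equality of the ordinals denoted. *)
Inductive cord : Set :=
| OZero : cord
| OSucc : cord -> cord
| OSup : (nat -> cord) -> cord.

Inductive ole : cord -> cord -> Prop :=
| ole_zero b : ole OZero b
| ole_succ a b : ole a b -> ole (OSucc a) (OSucc b)
| ole_sup_l f b : (forall n, ole (f n) b) -> ole (OSup f) b
| ole_sup_r a f n : ole a (f n) -> ole a (OSup f).

Definition oeq (a b : cord) : Prop := ole a b /\ ole b a.

Definition oaddn (a : cord) (k : nat) : cord := iter k OSucc a.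

Definition onat (k : nat) : cord := oaddn OZero k.

(** * Families of finite subsets of {1, 2, ...} *)

(* A finite set is encoded by the list of its elements in increasing order.
   The k-th element s(k) is therefore [nth 0 s k.-1], and initial segments are
   prefixes. *)
Definition finsub (s : seq nat) : bool := path ltn 0%N s.

Definition hat (F : set (seq nat)) : set (seq nat) :=
  [set t | exists2 s, F s & prefix t s].

Definition thin (F : set (seq nat)) : Prop :=
  forall s t, F s -> F t -> prefix t s -> t = s.

Definition hereditary (F : set (seq nat)) : Prop :=
  forall s t, F s -> finsub t -> {subset t <= s} -> F t.

Definition spreading (F : set (seq nat)) : Prop :=
  forall s t, F s -> finsub t -> size t = size s ->
    (forall i, (i < size s)%N -> (nth 0%N s i <= nth 0%N t i)%N) -> F t.

(* Coordinate [n] of [cantor_space] stands for the integer n + 1. *)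
Definition charf (s : seq nat) : cantor_space := fun n : nat => n.+1 \in s.

Definition compact_family (F : set (seq nat)) : Prop := closed (charf @` F).

Definition regular_family (F : set (seq nat)) : Prop :=
  [/\ F `<=` [set` finsub], hereditary F, spreading F & compact_family F].

Definition regular_thin (F : set (seq nat)) : Prop :=
  [/\ F `<=` [set` finsub], thin F & regular_family (hat F)].

(* [rk s] is the supremum of the [rk t] + 1 over the proper end-extensions [t]
   of [s] in the tree [T]; in particular it is 0 if [s] is maximal. *)
Definition rank_function (T : set (seq nat)) (rk : seq nat -> cord) : Prop :=
  forall s, T s ->
    (forall t, T t -> prefix s t -> s != t -> ole (OSucc (rk t)) (rk s)) /\
    (forall b, (forall t, T t -> prefix s t -> s != t -> ole (OSucc (rk t)) b) ->
       ole (rk s) b).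

Definition has_order (F : set (seq nat)) (xi : cord) : Prop :=
  hat F [::] /\
  exists2 rk, rank_function (hat F) rk & oeq (rk [::]) xi.

(* An infinite subset M of {1, 2, ...} is encoded by its increasing enumeration:
   M(k) is [M k.-1]. *)
Definition infsub (M : nat -> nat) : Prop :=
  (0 < M 0)%N /\ {homo M : m n / (m < n)%N}.

Definition restr (F : set (seq nat)) (M : nat -> nat) : set (seq nat) :=
  [set s | F s /\ [set` s] `<=` range M].

(* Positions are counted from 0 here. *)
Definition plegma (l : nat) (S : 'I_l -> seq nat) : Prop :=
  [/\ forall i, finsub (S i) /\ S i != [::],
      forall (i j : 'I_l) k, (i < j)%N ->
        (k < size (S i))%N -> (k < size (S j))%N ->
        (nth 0%N (S i) k < nth 0%N (S j) k)%N
    & forall (i j : 'I_l) k,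
        (k < size (S i))%N -> (k.+1 < size (S j))%N ->
        (nth 0%N (S i) k < nth 0%N (S j) k.+1)%N].

Definition plegma_pair (s t : seq nat) : Prop :=
  plegma (fun i : 'I_2 => if i == ord0 then s else t).

(** * Spreading models *)

(* A sequence together with the seminormed space of which it is a Hamel basis;
   that space is infinite dimensional since the basis is indexed by [nat].
   The term e_n is [sb_seq n.-1]. *)
Record seminormed_basis (R : realType) := SeminormedBasis {
  sb_space : lmodType R;
  sb_norm : sb_space -> R;
  sb_seq : nat -> sb_space;
  sb_normD : forall u v, sb_norm (u + v) <= sb_norm u + sb_norm v;
  sb_normZ : forall (a : R) u, sb_norm (a *: u) = `|a| * sb_norm u;
  sb_free : forall n (a : 'I_n -> R),
    \sum_(i < n) a i *: sb_seq i = 0 -> forall i, a i = 0;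
  sb_span : forall v, exists n (a : 'I_n -> R),
    v = \sum_(i < n) a i *: sb_seq i
}.

(* [x] is only evaluated on [restr F M].  The indices k and l of the usual
   definition are [m.+1] and [l.+1]. *)
Definition generates (R : realType) (X : normedModType R)
    (F : set (seq nat)) (M : nat -> nat) (x : seq nat -> X)
    (e : seminormed_basis R) : Prop :=
  exists delta : nat -> R,
    [/\ forall n, 0 < delta n,
        delta @ \oo --> (0 : R)
      & forall (m l : nat) (S : 'I_m.+1 -> seq nat) (a : 'I_m.+1 -> R),
          (m <= l)%N ->
          plegma S -> (forall j, restr F M (S j)) ->
          (M l <= nth 0%N (S ord0) 0)%N ->
          (forall j, -1 <= a j <= 1) ->
          `| `|\sum_(j < m.+1) a j *: x (S j)|
             - sb_norm (\sum_(j < m.+1) a j *: sb_seq e j) | <= delta l].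

Definition SM (R : realType) (xi : cord) (X : normedModType R) :
    seminormed_basis R -> Prop :=
  fun e => exists (F : set (seq nat)) (M : nat -> nat) (x : seq nat -> X),
     [/\ regular_thin F, has_order F xi, infsub M & generates F M x e].

(** * Schauder bases *)

Definition expansion (R : realType) (E : normedModType R)
    (b : nat -> E) (a : nat -> R) (x : E) : Prop :=
  series (fun n => a n *: b n) @ \oo --> x.

Definition schauder_basis (R : realType) (E : normedModType R)
    (b : nat -> E) : Prop :=
  forall x, exists! a : nat -> R, expansion b a x.

Definition supp (R : realType) (E : normedModType R) (b : nat -> E) (x : E) :
    set nat :=
  [set n | exists2 a : nat -> R, expansion b a x & a n != 0].

Definition plegma_block (R : realType) (E : normedModType R) (b : nat -> E)
    (F : set (seq nat)) (M : nat -> nat) (x : seq nat -> E) : Prop :=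
  (forall s, restr F M s -> finite_set (supp b (x s))) /\
  (forall s t, restr F M s -> restr F M t -> plegma_pair s t ->
     forall m n, supp b (x s) m -> supp b (x t) n -> (m < n)%N).

Definition plegma_block_SM (R : realType) (xi : cord) (E : normedModType R)
    (b : nat -> E) : seminormed_basis R -> Prop :=
  fun e => exists (F : set (seq nat)) (M : nat -> nat) (x : seq nat -> E),
     [/\ regular_thin F, has_order F xi, infsub M, plegma_block b F M x
       & generates F M x e].

(* The seminorm is a norm and [iota] exhibits [E] as the completion of the span
   of the sequence. *)
Definition generated_space (R : realType) (e : seminormed_basis R)
    (E : completeNormedModType R) (iota : {linear sb_space e -> E}) : Prop :=
  [/\ forall v : sb_space e, sb_norm v = 0 -> v = 0,
      forall v, `|iota v| = sb_norm v
    & dense (range iota)].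

(* Main.v *)
(** Write [t] for the first [k] elements of a set [v] and [s] for the rest. Since a family of
    order [k] is, on a tail, the family of all [k]-element sets, the given spreading model of
    [E] is generated by finite sums [y_t = sum_i a^t_i e_i], while [e] is generated by
    [(x_s)], [s] in a family [F] of order [xi]. The sets [v] with [s] in [F] form a family of
    order [xi + k], and on it one takes [z_v = sum_i a^t_i x_(s^i)], where the copies [s^i] of
    [s] are obtained by moving each element [n] of [s] down to the [i]-th place of a block of
    indices lying between the predecessor of [n] and [n]. In a plegma tuple [(v_j)] all the
    [t_j] lie below all the elements of the [s_j], so these blocks can be chosen long enough
    for all the supports involved, and far enough for the spreading model estimate to absorb
    the size of the coefficients. As the supports of the [y_(t_j)] are successive, each [i] is
    used by one [j] only, and the copies that occur form one long plegma tuple in [F]; hence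
    [|sum_j c_j z_(v_j)|] is close to [|sum_j c_j y_(t_j)|]. *)
Require Import Defs.
From mathcomp Require Import all_boot all_order all_algebra.
From mathcomp Require Import all_classical all_reals all_analysis.
From mathcomp Require Import zify.

Set Implicit Arguments.
Unset Strict Implicit.
Unset Printing Implicit Defensive.

Import Order.TTheory GRing.Theory Num.Theory.
Import numFieldNormedType.Exports.

Local Open Scope classical_set_scope.
Local Open Scope ring_scope.

(** * Countable ordinals *)

Lemma ole_refl a : ole a a.
Proof.
elim: a => [|a IH|f IH]; first exact: ole_zero.
- exact: ole_succ.
- by apply: ole_sup_l => n; apply: ole_sup_r (IH n).
Qed.

(** Plain inversion does not suffice: the last rule may be [ole_sup_r], when [b] is itself a
    supremum, so the induction runs over the derivation. *)
Lemma ole_supl_inv f b : ole (OSup f) b -> forall n, ole (f n) b.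
Proof.
move: {-1}(OSup f) (erefl (OSup f)) => a aE ab.
elim: ab f aE => // [f0 b0 H _ f [fE] n|a0 f0 n _ IH f /IH h m].
  by rewrite fE.
exact: ole_sup_r (h m).
Qed.

Lemma ole_succ_sup_inv a f : ole (OSucc a) (OSup f) -> exists n, ole (OSucc a) (f n).
Proof. by move=> H; inversion H; subst; exists n. Qed.

Lemma ole_succ_inv a b : ole (OSucc a) (OSucc b) -> ole a b.
Proof. by move=> H; inversion H. Qed.

Lemma ole_succ_zero a : ~ ole (OSucc a) OZero.
Proof. by move=> H; inversion H. Qed.

(** Induction on the first derivation. In the successor case [c] may be a supremum, which the inner
    induction on [c] unfolds until a successor appears. *)
Lemma ole_trans a b c : ole a b -> ole b c -> ole a c.
Proof.
move=> ab; elim: ab c => [{}b c _|{}a {}b ab IH c|f {}b fb IH c bc|{}a f n af IH c].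
- exact: ole_zero.
- elim: c => [/ole_succ_zero//|c _ /ole_succ_inv/IH|f IHf]; first exact: ole_succ.
  by move=> /ole_succ_sup_inv[n /IHf]; apply: ole_sup_r.
- by apply: ole_sup_l => n; apply: IH.
- by move=> /ole_supl_inv/(_ n); apply: IH.
Qed.

Lemma ole_S a : ole a (OSucc a).
Proof.
elim: a => [|a IH|f IH]; [exact: ole_zero|exact: ole_succ|].
apply: ole_sup_l => n; apply: ole_trans (IH n) _; apply: ole_succ.
exact/ole_sup_r/ole_refl.
Qed.

(** Since one ordinal has many notations, the induction on [b] proves accessibility for all [a]
    below or equal to [b] at once. *)
Lemma olt_wf : well_founded (fun a b => ole (OSucc a) b).
Proof.
suff H b a : ole a b -> Acc (fun a b => ole (OSucc a) b) a.
  by move=> b; apply: H (ole_refl b).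
elim: b a => [|b IH|f IH] a ab; constructor => c /ole_trans /(_ ab).
- by move/ole_succ_zero.
- by move/ole_succ_inv/IH.
- by move/ole_succ_sup_inv => [n] /(ole_trans (ole_S _))/IH.
Qed.

Lemma ole_oaddn a b m : ole a b -> ole (oaddn a m) (oaddn b m).
Proof. by move=> ab; elim: m => //= m IH; apply: ole_succ. Qed.

Lemma ole_oaddn_nat a m n : (m <= n)%N -> ole (oaddn a m) (oaddn a n).
Proof.
move=> /subnK <-; elim: (n - m)%N => [|p IH]; first exact: ole_refl.
exact: ole_trans IH (ole_S _).
Qed.

Lemma ole_onat m n : ole (onat m) (onat n) -> (m <= n)%N.
Proof.
elim: m n => // m IH [/ole_succ_zero//|n] /ole_succ_inv; exact: IH.
Qed.

(** * Finite sets as increasing lists *)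

Lemma mem_nthN (n : nat) (s : seq nat) :
  n \in s -> exists2 i, (i < size s)%N & nth 0%N s i = n.
Proof. by move=> /(nthP 0%N)[i]; exists i. Qed.

Lemma prefix_nat (s t : seq nat) : prefix s t -> exists r : seq nat, t = s ++ r.
Proof. by move=> /prefixP. Qed.

Lemma finsub_nth s i j : finsub s -> (i < j)%N -> (j < size s)%N ->
  (nth 0%N s i < nth 0%N s j)%N.
Proof.
move=> fs ij js; have /= ss := path_sorted fs.
by apply: (sorted_ltn_nth ltn_trans) => //; rewrite inE //; lia.
Qed.

Lemma finsubP s : reflect
  ((forall i, (i < size s)%N -> (0 < nth 0%N s i)%N) /\
   forall i, (i.+1 < size s)%N -> (nth 0%N s i < nth 0%N s i.+1)%N)
  (finsub s).
Proof.
apply: (iffP idP) => [fs|[s0 sS]].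
  split=> [|i si]; last exact: finsub_nth.
  case=> [|i] si; first by case: s fs si => //= x s /andP[].
  exact: leq_ltn_trans (finsub_nth fs (ltn0Sn i) si).
apply/(pathP 0%N) => -[|i] si /=; [exact: s0|exact: sS].
Qed.

Lemma finsub_gt0 s n : finsub s -> n \in s -> (0 < n)%N.
Proof. by move=> /finsubP[H _] /mem_nthN[i si <-]; apply: H. Qed.

Lemma finsub_uniq s : finsub s -> uniq s.
Proof. by move=> /path_sorted; apply: sorted_uniq; [exact: ltn_trans|exact: ltnn]. Qed.

Lemma finsub_take s k : finsub s -> finsub (take k s).
Proof. by move=> fs; have := fs; rewrite -{1}(cat_take_drop k s) /finsub cat_path => /andP[]. Qed.

Lemma finsub_drop s k : finsub s -> finsub (drop k s).
Proof.
move=> /finsubP[s0 sS]; apply/finsubP; rewrite size_drop; split=> i si; rewrite !nth_drop ?addnS.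
  by apply: s0; lia.
by apply: sS; lia.
Qed.

Lemma finsub_last s n : finsub s -> n \in s -> (n <= last 0%N s)%N.
Proof.
move=> fs /mem_nthN[i si <-]; rewrite -nth_last.
have [->|] := eqVneq i (size s).-1; first by [].
by move=> ne; apply/ltnW/finsub_nth => //; lia.
Qed.

Lemma finsub_cat s t : finsub s -> finsub t ->
  (forall n, n \in t -> (last 0%N s < n)%N) -> finsub (s ++ t).
Proof.
rewrite /finsub cat_path => -> /=.
by case: t => //= n t /andP[_ ->] H; rewrite H// inE eqxx.
Qed.

Lemma finsub_catP s t : finsub (s ++ t) -> forall m n, m \in s -> n \in t -> (m < n)%N.
Proof.
move=> fs m n /mem_nthN[i si <-] /mem_nthN[j tj <-].
have := @finsub_nth _ i (size s + j)%N fs; rewrite !nth_cat si size_cat.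
by rewrite [(_ + _ < size s)%N]ltnNge leq_addr /= addKn; apply; lia.
Qed.

Lemma finsub_rcons s n : finsub s -> (last 0%N s < n)%N -> finsub (rcons s n).
Proof. by rewrite /finsub rcons_path => ->. Qed.

Lemma hatW F s : F s -> hat F s.
Proof. by exists s => //; apply: prefix_refl. Qed.

Lemma hat_prefix F s t : hat F t -> prefix s t -> hat F s.
Proof. by move=> [u Fu tu] st; exists u => //; apply: prefix_trans tu. Qed.

Lemma hat_rcons F s : hat F s -> ~ F s -> exists n, hat F (rcons s n).
Proof.
move=> [u Fu /prefix_nat[[|n r] uE]] nFs; first by rewrite cats0 in uE; rewrite uE in Fu.
by exists n, u => //; rewrite uE -cat_rcons prefix_prefix.
Qed.

Lemma thin_hat F s t : thin F -> F s -> hat F t -> prefix s t -> s = t.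
Proof.
move=> tF Fs [u Fu tu] st; move: (prefix_trans st tu) => /(tF _ _ Fu Fs) su.
have := size_prefix tu; have := size_prefix st; move: st => /prefix_nat[r ->].
rewrite su size_cat; case: r => [|? r /=]; first by rewrite cats0.
by move=> _ ?; exfalso; lia.
Qed.

(** Carries an end-extension of [s] over to [s']: translating [r] beyond the last element of [s']
    keeps the list increasing and only moves entries up. The extra shift [d] leaves room to pass a
    prescribed bound. *)
Lemma spreading_shift (T : set (seq nat)) s r s' d : spreading T -> finsub s' ->
  T (s ++ r) -> finsub (s ++ r) ->
  size s' = size s -> (forall i, (i < size s)%N -> (nth 0%N s i <= nth 0%N s' i)%N) ->
  let t := s' ++ [seq (last 0 s' + d + n)%N | n <- r] in
  [/\ T t, finsub t, prefix s' t & size t = size (s ++ r)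
      /\ forall i, (i < size (s ++ r))%N -> (nth 0%N (s ++ r) i <= nth 0%N t i)%N].
Proof.
move=> sprT fs' Tsr fsr ss' les t.
have st : size t = size (s ++ r) by rewrite !size_cat size_map ss'.
have ft : finsub t.
  apply: finsub_cat => //.
    have : finsub r by rewrite -(drop_size_cat r (erefl (size s))) finsub_drop.
    move=> /finsubP[r0 rS]; apply/finsubP; rewrite size_map.
    split=> i ir; rewrite !(nth_map 0%N) //; try lia.
    - by have := r0 i ir; lia.
    - by have := rS i ir; lia.
  move=> n /mapP[m mr ->]; have : (0 < m)%N by apply: finsub_gt0 fsr _; rewrite mem_cat mr orbT.
  by lia.
have let_ i : (i < size (s ++ r))%N -> (nth 0%N (s ++ r) i <= nth 0%N t i)%N.
  rewrite /t !nth_cat ss' size_cat => isr; case: ltnP => [/les//|si].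
  by rewrite (nth_map 0%N) ?leq_addl//; lia.
split=> //; last exact: prefix_prefix.
exact: sprT Tsr ft st let_.
Qed.

(** Every proper extension of [s] shifts to one of [s'] of the same size, so the tree above [s'] is
    at least as high; well-founded induction on the rank of [s] compares the two. *)
Lemma rank_spread T rk s s' : rank_function T rk -> T `<=` [set` finsub] -> spreading T ->
  T s -> T s' -> size s' = size s ->
  (forall i, (i < size s)%N -> (nth 0%N s i <= nth 0%N s' i)%N) ->
  ole (rk s) (rk s').
Proof.
move=> rkT fT sT; move: {-1}(rk s) (erefl (rk s)) => a.
elim/(well_founded_ind olt_wf): a s s' => a IH s s' aE Ts Ts' ss' les.
rewrite -{}aE in IH *; apply: (rkT s Ts).2 => t Tt /prefix_nat[r tE] st.
have [] := @spreading_shift T s r s' 0 sT (fT _ Ts') _ _ ss' les; rewrite -?tE//.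
  exact: fT.
set t' := s' ++ _ => Tt' ft' st' [ztt' lett'].
apply: (@ole_trans _ (OSucc (rk t'))).
  apply: ole_succ; apply: (IH (rk t)) => //.
  by apply: (rkT s Ts).1 => //; rewrite tE prefix_prefix.
apply: (rkT s' Ts').1 => //.
apply: contra_neqN st => /eqP s't'; apply/eqP; rewrite tE.
have : size r = 0%N by move: ztt'; rewrite -s't' tE size_cat; lia.
by move/size0nil ->; rewrite cats0.
Qed.

(** * Compactness of hereditary families *)

Lemma cantor_cylinder (c : cantor_space) n :
  nbhs c [set d | forall i, (i < n)%N -> d i = c i].
Proof.
elim: n => [|n IH]; first exact: filterS filterT.
have : nbhs c [set d : cantor_space | d n = c n].
  exact: (@proj_continuous nat (fun=> bool) n c [set c n] (discrete_set1 _)).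
move=> /filterI /(_ IH); apply: filterS => d [/= dn dlt] i.
by rewrite ltnS leq_eqVlt => /predU1P[->//|/dlt].
Qed.

Lemma cantor_cvg (u : nat -> cantor_space) (c : cantor_space) :
  (forall i, \forall n \near \oo, u n i = c i) -> u @ \oo --> c.
Proof.
move=> H; apply/cvg_sup => i U [V] [[W] oW <-] Wci WU.
have [N _ uN] := H i; apply: (filterS WU); rewrite nbhs_simpl.
by exists N => // n /uN /= ->.
Qed.

Lemma cylinder_closure (A : set cantor_space) c n : closure A c ->
  exists2 d, A d & forall i, (i < n)%N -> d i = c i.
Proof. by move=> /(_ _ (cantor_cylinder c n))[d [? ?]]; exists d. Qed.

(** The limit of an infinite branch would be the characteristic function of a finite set containing
    the whole branch. Conversely, the finite pieces of a limit point lie in [T] by heredity, so a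
    limit point with infinite support yields a branch. *)
Lemma hereditary_compact (T : set (seq nat)) : T `<=` [set` finsub] -> hereditary T ->
  compact_family T <->
  ~ exists N : nat -> nat, infsub N /\ forall n, T (mkseq N n).
Proof.
move=> fT hT; split=> [cT [N [[N0 Nlt] TN]]|nb c clc].
  have Nle : {homo N : m n / (m <= n)%N} by exact: ltnW_homo.
  pose c : cantor_space := fun n => `[< exists i, N i = n.+1 >].
  have [s Ts sE] : (charf @` T) c.
    pose u n : cantor_space := charf (mkseq N n).
    have uc : u @ \oo --> c.
      apply: cantor_cvg => i; exists i.+1 => // n /= ilen; apply/idP/asboolP.
        by move=> /mapP[j _ jE]; exists j.
      move=> [j jE]; rewrite /u /charf -jE; apply: map_f.
      have : forall j, (j < N j)%N.
        by elim=> // p; have := Nlt p p.+1 (ltnSn p); lia.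
      by move=> /(_ j); rewrite mem_iota; lia.
    apply: (closed_cvg _ cT _ _ uc).
    by apply: nearW => n; exists (mkseq N n).
  have sub : {subset mkseq N (size s).+1 <= s}.
    move=> _ /mapP[i _ ->]; have : c (N i).-1.
      have Ni : (0 < N i)%N by apply: leq_trans N0 (Nle _ _ _).
      by apply/asboolP; exists i; lia.
    by rewrite -sE /charf prednK//; apply: leq_trans N0 (Nle _ _ _).
  have := uniq_leq_size (finsub_uniq (fT _ (TN _))) sub.
  by rewrite size_mkseq ltnn.
pose C n := [seq i <- iota 1 n | c i.-1].
have CT n : T (C n).
  have [_ [s Ts <-] sE] := cylinder_closure n clc.
  apply: (hT s) => //.
    apply: (@path_filter _ _ ltn_trans).
    by elim: n 0%N {sE} => //= n IH m; rewrite ltnSn IH.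
  move=> i; rewrite mem_filter mem_iota => /andP[ci /andP[i1 iS]].
  have : charf s i.-1 by rewrite sE; lia.
  by rewrite /charf prednK.
have Cin n i : (i < n)%N -> c i -> i.+1 \in C n.
  by move=> iltn ci; rewrite mem_filter mem_iota ci; lia.
have [[n0 cn0]|inf] := pselect (exists n, forall i, (n <= i)%N -> c i = false).
  exists (C n0) => //; apply/funext => i; rewrite /charf.
  case: (ltnP i n0) => ilt.
    apply/idP/idP; last exact: Cin.
    by rewrite mem_filter => /andP[].
  by rewrite cn0//; apply/negbTE; rewrite mem_filter mem_iota; lia.
have /choice[nx nxP] : forall n, exists m, (n <= m)%N /\ c m.
  move=> n.
  apply: contrapT => H; apply: inf; exists n => i ni; apply/negbTE/negP => ci.
  by apply: H; exists i.
exfalso; apply: nb.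
(* Coordinate [m] stands for the integer [m.+1], so a search started at coordinate [N p] returns an
   integer strictly above [N p]. *)
pose N := fix N n := if n is p.+1 then (nx (N p)).+1 else (nx 0%N).+1.
have NS p : (N p < N p.+1)%N by rewrite /= ltnS (nxP _).1.
have Nlt : {homo N : m n / (m < n)%N} by apply: homo_ltn => //; exact: ltn_trans.
have Nc p : c (N p).-1 by case: p => [|p]; rewrite /= (nxP _).2.
have N1 p : (0 < N p)%N by case: p.
have Nle : {homo N : m n / (m <= n)%N} by exact: ltnW_homo.
exists N; split=> // n; apply: (hT _ _ (CT (N n))).
  apply/finsubP; rewrite size_mkseq; split=> i ilt; rewrite !nth_mkseq//; lia.
move=> x /mapP[i]; rewrite mem_iota => /andP[_ ilt] ->.
by rewrite -[N i]prednK// Cin//; have := Nlt i n; lia.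
Qed.

(** * The family of order [xi + k] *)

(** The free elements come first: the tree has [k] levels below copies of the tree of [F], which
    makes the order [xi + k] rather than [k + xi]. *)
Definition prepend (k : nat) (F : set (seq nat)) : set (seq nat) :=
  [set v | [/\ finsub v, (k <= size v)%N & F (drop k v)]].

(** Positive order forces a nonempty member of the tree; heredity keeps its first element, and
    spreading moves it to the right. *)
Lemma singletons_hat F xi : regular_thin F -> has_order F xi -> ole (onat 1) xi ->
  exists n0, forall n, (n0 <= n)%N -> hat F [:: n].
Proof.
move=> [_ _ [fF hF sF _]] [F0 [rk rkF [_ rkE]]] xi1.
have [u Fu u0] : exists2 u, hat F u & u != [::].
  apply: contrapT => H; apply: (@ole_succ_zero OZero).
  apply: (ole_trans (ole_trans xi1 rkE)); apply: (rkF _ F0).2 => t Ft _ t0.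
  by exfalso; apply: H; exists t => //; rewrite eq_sym.
case: u u0 Fu => // m u _ Fu; have fu : finsub (m :: u) := fF _ Fu.
have m0 : (0 < m)%N by case/andP: fu.
exists m => n mn; apply: (sF [:: m]) => //.
- apply: hF Fu _ _; first by rewrite /finsub /= m0.
  by move=> i; rewrite !inE => /eqP ->; rewrite eqxx.
- by rewrite /finsub /= (leq_trans m0 mn).
- by case.
Qed.

Lemma finsub_extend w m : finsub w -> (size w <= m)%N ->
  exists2 w', finsub w' & prefix w w' /\ size w' = m.
Proof.
move=> fw /subnKC <-; elim: (m - size w)%N => [|p [w' fw' [ww' sw']]].
  by exists w; rewrite ?addn0 ?prefix_refl.
exists (rcons w' (last 0%N w').+1); first exact: finsub_rcons.
by rewrite size_rcons sw' addnS; split=> //; apply: prefix_trans ww' (prefix_rcons _ _).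
Qed.

Section Prepend.
Variables (k : nat) (F : set (seq nat)).
Hypotheses (rF : regular_thin F) (F0 : hat F [::]).
Hypothesis F1 : exists n0, forall n, (n0 <= n)%N -> hat F [:: n].

Let fF : hat F `<=` [set` finsub]. Proof. by case: rF => _ _ []. Qed.
Let sF : spreading (hat F). Proof. by case: rF => _ _ []. Qed.

Lemma hat_nonempty_above n : exists2 s, F s & s != [::] /\ finsub s /\ forall m, m \in s -> (n < m)%N.
Proof.
have [n0 /(_ (maxn n0 n.+1) (leq_maxl _ _))] := F1.
move=> [s Fs ms]; have fs : finsub s := fF (hatW Fs).
exists s => //; case: s ms Fs fs => // m s; rewrite prefix_cons => /andP[/eqP <- _] _ fs.
split=> //; split=> // p; rewrite inE => /predU1P[->|ps]; first exact: leq_maxr.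
have := @finsub_catP [:: maxn n0 n.+1] s fs (maxn n0 n.+1) p; rewrite !inE eqxx => /(_ isT ps).
by apply: leq_ltn_trans; apply: leq_trans (leq_maxr _ _).
Qed.

(** A set with more than [k] elements is completed by completing its tail in [F]. A shorter one is
    first lengthened to [k] elements, then followed by a member of [F] lying further right. *)
Lemma hat_prepend w : hat (prepend k F) w <-> finsub w /\ hat F (drop k w).
Proof.
split=> [[v [fv kv Fv] /prefix_nat[r vE]]|[fw Fw]].
  have fw : finsub w by rewrite -(take_size_cat r (erefl (size w))) -vE finsub_take.
  split=> //; have [wk|kw] := leqP (size w) k; first by rewrite drop_oversize.
  by apply: hat_prefix (hatW Fv) _; rewrite vE drop_cat kw prefix_prefix.
have [wk|kw] := leqP (size w) k; last first.
  have [s Fs /prefix_nat[r sE]] := Fw; exists (w ++ r); last exact: prefix_prefix.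
  have dE : drop k (w ++ r) = s by rewrite drop_cat kw sE.
  split; rewrite ?dE//; last by rewrite size_cat; lia.
  have fs : finsub s := fF (hatW Fs); rewrite -(cat_take_drop k w) -catA -sE.
  have := fw; rewrite -{1}(cat_take_drop k w) /finsub !cat_path => /andP[-> /=].
  have : drop k w != [::] by rewrite -size_eq0 size_drop -lt0n subn_gt0.
  move: fs; rewrite sE; case: (drop k w) => //= x w' + _.
  by rewrite /finsub /= => /andP[_ ->] /andP[-> _].
have [w' fw' [ww' sw']] := finsub_extend fw wk.
have [s Fs [s0 [fs sw]]] := hat_nonempty_above (last 0%N w').
exists (w' ++ s); last exact: prefix_trans ww' (prefix_prefix _ _).
split; first exact: finsub_cat.
  by rewrite size_cat; lia.
by rewrite -sw' drop_size_cat.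
Qed.

Lemma thin_prepend : thin (prepend k F).
Proof.
move=> u v [fu ku Fu] [fv kv Fv] /prefix_nat[r uE].
have [_ tF _] := rF.
have := tF _ _ Fu Fv; rewrite uE drop_cat ltn_neqAle kv andbT.
case: eqVneq => [kE|_] /=; last first.
  rewrite prefix_prefix => /(_ isT) /(congr1 size) /eqP.
  by rewrite size_cat -{1}[size (drop k v)]addn0 eqn_add2l; case: (r) => //; rewrite cats0.
(* If [v] has exactly [k] elements, its tail is empty, and thinness of [F] forces the tail of [u] to
   be empty too. *)
by rewrite kE subnn drop0 drop_size => /(_ (prefix0s _)) <-; rewrite cats0.
Qed.

(** By counting: an element of [drop k t] among the first [k] elements of [s] would put it and all
    of [take k t], hence [k.+1] distinct numbers, into [take k s]. *)
Lemma subset_drop s t : finsub s -> finsub t -> {subset t <= s} -> {subset drop k t <= drop k s}.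
Proof.
move=> fs ft ts n nt; have : n \in s by exact: ts (mem_drop nt).
rewrite -{1}(cat_take_drop k s) mem_cat => /orP[ns|//]; exfalso.
have tkt : (k < size t)%N by rewrite ltnNge; apply: contraTN nt => /drop_oversize ->.
have : {subset rcons (take k t) n <= take k s}.
  move=> p; rewrite mem_rcons inE => /predU1P[->//|pt].
  have : p \in s by exact: ts (mem_take pt).
  rewrite -{1}(cat_take_drop k s) mem_cat => /orP[//|ps]; exfalso.
  have := @finsub_catP (take k s) (drop k s); rewrite cat_take_drop => /(_ fs _ _ ns ps).
  have := @finsub_catP (take k t) (drop k t); rewrite cat_take_drop => /(_ ft _ _ pt nt).
  by lia.
move/uniq_leq_size; rewrite rcons_uniq (finsub_uniq (finsub_take k ft)) andbT.
rewrite size_rcons (size_takel (ltnW tkt)) size_take_min => H.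
suff /H : n \notin take k t by lia.
apply/negP => nt'.
have := @finsub_catP (take k t) (drop k t); rewrite cat_take_drop => /(_ ft _ _ nt' nt).
by rewrite ltnn.
Qed.

Lemma regular_thin_prepend : regular_thin (prepend k F).
Proof.
have [_ _ [_ hF _ cF]] := rF.
have fH : hat (prepend k F) `<=` [set` finsub] by move=> w /hat_prepend[].
have hH : hereditary (hat (prepend k F)).
  move=> s t /hat_prepend[fs Fs] ft ts; apply/hat_prepend; split=> //.
  by apply: hF Fs _ _; [exact: finsub_drop|exact: subset_drop].
split; [by move=> v []|exact: thin_prepend|split=> //].
  move=> s t /hat_prepend[fs Fs] ft ts st; apply/hat_prepend; split=> //.
  apply: sF Fs _ _ _; rewrite ?size_drop ?ts//; first exact: finsub_drop.
  by move=> i ik; rewrite !nth_drop; apply: st; lia.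
(* Without its first [k] elements, an infinite branch of the new tree is an infinite branch of
   [hat F]. *)
apply/(hereditary_compact fH hH) => -[N [[N0 Nlt] HN]].
move/(hereditary_compact fF hF): cF; apply.
have Nle : {homo N : m n / (m <= n)%N} by exact: ltnW_homo.
exists (fun n => N (k + n)%N); split=> [|n].
  by split=> [|m n mn]; [exact: leq_trans N0 (Nle _ _ _)|apply: Nlt; lia].
have /hat_prepend[_] := HN (k + n)%N; congr (hat F _).
rewrite /mkseq iotaD map_cat drop_size_cat ?size_map ?size_iota// add0n.
by rewrite -[in LHS](addn0 k) iotaDl -map_comp.
Qed.

Lemma rank_prepend rk : rank_function (hat F) rk ->
  rank_function (hat (prepend k F)) (fun w => oaddn (rk (drop k w)) (k - size w)).
Proof.
move=> rkF w /hat_prepend[fw Fw]; split=> [t /hat_prepend[ft Ft] wt ne|b H].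
  have ltwt : (size w < size t)%N.
    move: ne wt => /eqP ne /prefix_nat[[|x r] tE]; first by rewrite cats0 in tE; rewrite tE in ne.
    by rewrite tE size_cat /=; lia.
  have [kw|wk] := leqP k (size w).
    have [-> ->] : (k - size w = 0)%N /\ (k - size t = 0)%N by lia.
    apply: (rkF _ Fw).1 => //.
      move/prefix_nat: wt => [r ->]; rewrite drop_cat ltn_neqAle kw andbT.
      by case: eqVneq => [->|_]; rewrite ?subnn ?drop0 ?drop_size ?prefix0s ?prefix_prefix.
    by apply/eqP => /(congr1 (@size nat)); rewrite !size_drop; lia.
  rewrite (drop_oversize (ltnW wk)).
  have [tk|kt] := leqP (size t) k.
    rewrite (drop_oversize tk).
    have -> : (k - size w = (k - size t) + (size t - size w).-1.+1)%N by lia.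
    rewrite -[OSucc _]/(oaddn _ (k - size t).+1).
    by apply: ole_oaddn_nat; lia.
  have -> : (k - size t = 0)%N by lia.
  apply: (@ole_trans _ (rk [::])); last exact: (@ole_oaddn_nat _ 0).
  apply: (rkF _ F0).1 => //; first by rewrite prefix0s.
  by rewrite eq_sym -size_eq0 size_drop -lt0n subn_gt0.
have [kw|wk] := leqP k (size w); last first.
  (* Below length [k], the supremum is already attained at a one-element extension. *)
  have wE : (k - size w = (k - (size w).+1).+1)%N by lia.
  have := H (rcons w (last 0%N w).+1); rewrite size_rcons drop_oversize ?size_rcons//.
  rewrite (drop_oversize (ltnW wk)) wE; apply.
  - apply/hat_prepend; split; first exact: finsub_rcons.
    by rewrite drop_oversize ?size_rcons.
  - exact: prefix_rcons.
  - by apply/eqP => /(congr1 size); rewrite size_rcons; lia.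
have -> : (k - size w = 0)%N by lia.
apply: (rkF _ Fw).2 => r Fr /prefix_nat[q rE] ne.
(* When [drop k w] is empty, [r] may start below the last element of [w], so it need not extend [w].
   Its shift [r'] does, and has at least the same rank. *)
pose r' := drop k w ++ [seq (last 0 w + n)%N | n <- q].
have fr : finsub r := fF Fr.
have fq : finsub q by rewrite -(drop_size_cat q (erefl (size (drop k w)))) finsub_drop// -rE.
(* Chosen so that [spreading_shift], which translates by the last element of [drop k w] plus [d],
   translates by the last element of [w]. *)
pose d := (last 0 w - last 0 (drop k w))%N.
have lw : (last 0 (drop k w) <= last 0 w)%N.
  by rewrite -{2}(cat_take_drop k w) last_cat; case: (drop k w) => //=.
have [] := @spreading_shift (hat F) (drop k w) q (drop k w) d sF (finsub_drop k fw) _ _ (erefl _) _.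
- by rewrite -rE.
- by rewrite -rE.
- by [].
rewrite /d subnKC// -/r' -rE => Fr' fr' wr' [zr' ler'].
apply: (@ole_trans _ (OSucc (rk r'))).
  by apply: ole_succ; apply: (rank_spread rkF fF sF).
have dE : drop k (take k w ++ r') = r' by rewrite drop_size_cat// size_takel.
have tE : take k w ++ r' = w ++ [seq (last 0 w + n)%N | n <- q].
  by rewrite /r' catA cat_take_drop.
have := H (take k w ++ r'); rewrite dE.
have -> : (k - size (take k w ++ r') = 0)%N by rewrite size_cat size_takel//; lia.
apply.
- apply/hat_prepend; split; last by rewrite dE.
  rewrite tE; apply: finsub_cat => //.
    have /finsubP[q0 qS] := fq; apply/finsubP; rewrite size_map; split=> i iq.
      by rewrite (nth_map 0%N)//; have := q0 i iq; lia.
    by rewrite !(nth_map 0%N)//; [have := qS i iq|]; lia.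
  by move=> n /mapP[m mq ->]; have := finsub_gt0 fq mq; lia.
- by rewrite tE prefix_prefix.
- rewrite tE; apply/eqP => /(congr1 size)/eqP.
  rewrite size_cat -{1}[size w]addn0 eqn_add2l size_map eq_sym size_eq0 => /eqP q0.
  by move: ne; rewrite rE q0 cats0 eqxx.
Qed.

Lemma has_order_prepend xi : has_order F xi -> has_order (prepend k F) (oaddn xi k).
Proof.
move=> [_ [rk rkF [rx xr]]]; split; first by apply/hat_prepend.
exists (fun w => oaddn (rk (drop k w)) (k - size w)); first exact: rank_prepend.
by rewrite subn0; split; apply: ole_oaddn.
Qed.

End Prepend.

(** * Thinning *)

(** Each element added along a branch lowers the rank by at least one. *)
Lemma rank_size T rk s : rank_function T rk ->
  (forall s t, T t -> prefix s t -> T s) -> T s ->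
  ole (oaddn (rk s) (size s)) (rk [::]).
Proof.
move=> rkT pT; elim/last_ind: s => [|s n IH] Ts /=; first exact: ole_refl.
have Ts' : T s by apply: pT Ts _; rewrite prefix_rcons.
apply: ole_trans (IH Ts'); rewrite size_rcons /oaddn iterSr.
apply: ole_oaddn; apply: (rkT s Ts').1 => //; first exact: prefix_rcons.
by apply/eqP => /(congr1 (@size nat)); rewrite size_rcons; lia.
Qed.

(** The rank bounds all lengths by [k] and forces some length to be [k]. Spreading puts every later
    [k]-set in the tree, where it is maximal and hence in [G]. *)
Lemma finite_order_tail G k : (0 < k)%N -> regular_thin G -> has_order G (onat k) ->
  exists n0, forall t, finsub t -> size t = k -> {in t, forall n, (n0 <= n)%N} -> G t.
Proof.
move=> k0 [_ _ [fG _ sG _]] [G0 [rk rkG [rk_le rk_ge]]].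
have pT s t : hat G t -> prefix s t -> hat G s by exact: hat_prefix.
have size_le s : hat G s -> (size s <= k)%N.
  move=> /(rank_size rkG pT) H; apply: ole_onat.
  apply: ole_trans rk_le; apply: ole_trans H; apply: ole_oaddn; exact: ole_zero.
have [s0 Gs0 s0k] : exists2 s, hat G s & size s = k.
  apply: contrapT => H.
  have size_lt s : hat G s -> (size s < k)%N.
    move=> Gs; have := size_le s Gs; rewrite leq_eqVlt => /predU1P[sk|//].
    by exfalso; apply: H; exists s.
  (* If all lengths were below [k], every rank would be one less than the remaining length allows,
     and the root would have rank at most [k.-1]. *)
  have rk_le' p s : hat G s -> (k - size s <= p.+1)%N -> ole (rk s) (onat p).
    elim: p s => [|p IH] s Gs sp; apply: (rkG _ Gs).2 => t Gt /prefix_nat[[|m r] tE].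
    - by rewrite tE cats0 eqxx.
    - by have := size_lt _ Gt; rewrite tE size_cat /=; lia.
    - by rewrite tE cats0 eqxx.
    - move=> _; apply: ole_succ; apply: IH => //.
      by have := size_lt _ Gt; rewrite tE size_cat /=; lia.
  have := ole_trans rk_ge (rk_le' k.-1 [::] G0 _); rewrite /= subn0 prednK// => /(_ (leqnn _)).
  by move/ole_onat; lia.
exists (last 0%N s0) => t ft tk tn0.
have [u Gu tu] : hat G t.
  apply: (sG _ _ Gs0 ft); rewrite s0k //= => i ik.
  apply: (@leq_trans (last 0%N s0)); last by apply: tn0; rewrite mem_nth ?tk.
  by apply: finsub_last; [exact: fG|rewrite mem_nth ?s0k].
have /prefix_nat[r uE] := tu.
have := size_le u (hatW Gu); rewrite uE size_cat tk => rk0.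
have r0 : r = [::] by apply: size0nil; lia.
by move: Gu; rewrite uE r0 cats0.
Qed.

(** There are finitely many sets with elements at most [n]; the induction splits them by whether
    [n.+1] is the last element. A running maximum makes the bound monotone. *)
Lemma finsub_bound (f : seq nat -> nat) : exists B : nat -> nat,
  {homo B : m n / (m <= n)%N} /\
  forall n u, finsub u -> {in u, forall i, (i <= n)%N} -> (f u <= B n)%N.
Proof.
have H n : forall g : seq nat -> nat, exists b,
    forall u, finsub u -> {in u, forall i, (i <= n)%N} -> (g u <= b)%N.
  elim: n => [|n IH] g.
    exists (g [::]) => -[//|i u] fu /(_ i (mem_head _ _)).
    by rewrite leqn0 => /eqP iE; move: fu; rewrite iE.
  have [b1 b1P] := IH g; have [b2 b2P] := IH (fun u => g (rcons u n.+1)).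
  exists (maxn b1 b2); elim/last_ind => [|u i _] fu un.
    by rewrite leq_max b1P.
  have fu' : finsub u by move: fu; rewrite /finsub rcons_path => /andP[].
  have ui j : j \in u -> (j < i)%N.
    by move=> ju; apply: (@finsub_catP u [:: i]) => //; rewrite ?cats1// inE.
  have : (i <= n.+1)%N by apply: un; rewrite mem_rcons mem_head.
  rewrite leq_eqVlt ltnS => /predU1P[iE|iln].
    rewrite iE leq_max b2P ?orbT// => j ju.
    by have := ui j ju; rewrite iE.
  rewrite leq_max b1P// => j; rewrite mem_rcons inE => /predU1P[->//|/ui ji].
  exact: leq_trans (ltnW ji) iln.
have /choice[B0 B0P] : forall n, exists b,
    forall u, finsub u -> {in u, forall i, (i <= n)%N} -> (f u <= b)%N.
  by move=> n; apply: H.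
exists (fun n => \max_(i < n.+1) B0 i); split.
  move=> m n mn; apply/bigmax_leqP => i _.
  by have := @leq_bigmax _ (fun i : 'I_n.+1 => B0 i) (widen_ord (mn : (m.+1 <= n.+1)%N) i).
move=> n u fu un; apply: leq_trans (B0P n u fu un) _.
exact: (@leq_bigmax _ (fun i : 'I_n.+1 => B0 i) ord_max).
Qed.

Lemma infsub_gt M n : infsub M -> (n < M n)%N.
Proof.
by move=> [M0 Mlt]; elim: n => // n IH; have := Mlt n n.+1 (ltnSn n); lia.
Qed.

Lemma infsub_le M : infsub M -> {homo M : m n / (m <= n)%N}.
Proof. by move=> [_ Mlt]; apply: ltnW_homo. Qed.

Lemma infsub_thin M (f : nat -> nat) : infsub M -> exists L, [/\ infsub L,
  range L `<=` range M, (f 0%N <= L 0%N)%N & forall n, (f (L n) <= L n.+1)%N].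
Proof.
move=> iM; pose L := fix L n := if n is p.+1 then M (maxn (f (L p)) (L p)) else M (f 0%N).
have Mgt n : (n < M n)%N by exact: infsub_gt.
have LS n : (f (L n) <= L n.+1)%N /\ (L n < L n.+1)%N.
  by have := Mgt (maxn (f (L n)) (L n)); rewrite [L n.+1]/=; lia.
exists L; split; last by move=> n; case: (LS n).
- split; first by apply: leq_ltn_trans (Mgt _).
  by apply: homo_ltn => [|n]; [exact: ltn_trans|case: (LS n)].
- by move=> _ [[|n] _ <-] /=; [exists (f 0%N)|exists (maxn (f (L n)) (L n))].
- exact/ltnW/Mgt.
Qed.

Lemma range_sub_le (M L : nat -> nat) n : infsub M -> infsub L -> range L `<=` range M -> (M n <= L n)%N.
Proof.
move=> iM iL LM; have /choice[h hE] : forall n, exists m, M m = L n.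
  by move=> m; have [j _ <-] := LM (L m) (ex_intro2 _ _ m I erefl); exists j.
suff : (n <= h n)%N by move=> /(infsub_le iM); rewrite hE.
have hlt m p : (m < p)%N -> (h m < h p)%N.
  move=> mp; rewrite ltnNge; apply/negP => /(infsub_le iM).
  by rewrite !hE leqNgt iL.2.
by elim: n => // n IH; have := hlt n n.+1 (ltnSn n); lia.
Qed.

(** Each node outside [F] has some successor [q u]. Making [L] outgrow a uniform bound for [q], any
    later element of [L] exceeds [q u], and spreading applies. *)
Lemma hat_step F M : regular_thin F -> infsub M -> exists L, [/\ infsub L,
  range L `<=` range M &
  forall u n, hat F u -> ~ F u -> [set` rcons u n] `<=` range L ->
    finsub (rcons u n) -> hat F (rcons u n)].
Proof.
move=> [_ _ [fF _ sF _]] iM.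
have /choice[q qP] : forall u, exists q, hat F u -> ~ F u -> hat F (rcons u q).
  move=> u; have [[Fu nFu]|H] := pselect (hat F u /\ ~ F u).
    by have [q Fq] := hat_rcons Fu nFu; exists q.
  by exists 0%N => ? ?; exfalso; apply: H.
have [B [_ BP]] := finsub_bound q.
have [L [iL LM L0 LB]] := infsub_thin B iM.
exists L; split=> // u n Fu nFu unL fun_.
have fu : finsub u := fF _ Fu.
apply: (sF _ _ (qP u Fu nFu) fun_); rewrite !size_rcons// => i iu.
rewrite !nth_rcons; case: ltnP => // iu'; rewrite (_ : i == size u); last by apply/eqP; lia.
have [|p _ pn] := unL n; first by rewrite /= mem_rcons mem_head.
have lt_n j : j \in u -> (j < n)%N.
  by move=> ju; apply: (@finsub_catP u [:: n]); rewrite ?cats1// inE.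
have le_p j : j \in u -> exists2 r, (r < p)%N & L r = j.
  move=> ju; have [|r _ rj] := unL j; first by rewrite /= mem_rcons inE ju orbT.
  exists r => //; rewrite ltnNge; apply/negP => /(infsub_le iL).
  by rewrite rj pn leqNgt lt_n.
(* If [n] is the first element of [L], then [u] is empty and the bound at 0 is the one to use. *)
rewrite -pn; case: p le_p {pn} => [|p] le_p.
  apply: leq_trans L0; apply: BP => // j /le_p[r]; by rewrite ltn0.
apply: leq_trans (LB p); apply: BP => // j /le_p[r rp <-].
exact: infsub_le.
Qed.

(* If [w] had no initial segment in [F], it could be extended within the tree and, by
   spreading, so could [s]. *)
Lemma prefix_below F L s w : regular_thin F -> infsub L -> hat F [::] ->
  (forall u n, hat F u -> ~ F u -> [set` rcons u n] `<=` range L ->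
    finsub (rcons u n) -> hat F (rcons u n)) ->
  F s -> finsub w -> size w = size s -> [set` w] `<=` range L ->
  (forall i, (i < size s)%N -> (nth 0%N w i <= nth 0%N s i)%N) ->
  exists2 u, F u & prefix u w.
Proof.
move=> [_ tF [fF _ sF _]] iL F0 step Fs fw wsz wL ws.
have fs : finsub s := fF _ (hatW Fs).
suff H p : (p <= size w)%N -> (exists2 u, F u & prefix u w) \/ (hat F (take p w) /\ ~ F (take p w)).
  have [//|[]] := H _ (leqnn _); rewrite take_size => Fw nFw; exfalso.
  pose m := L (maxn (last 0%N w) (last 0%N s)).
  have mgt : (maxn (last 0%N w) (last 0%N s) < m)%N := infsub_gt _ iL.
  have Fwm : hat F (rcons w m).
    apply: step => //; last by apply: finsub_rcons => //; lia.
    by move=> j; rewrite /= mem_rcons inE => /predU1P[->|/wL//]; exists (maxn (last 0%N w) (last 0%N s)).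
  have Fsm : hat F (rcons s m).
    apply: sF Fwm _ _ _; first by apply: finsub_rcons => //; lia.
      by rewrite !size_rcons wsz.
    move=> i; rewrite size_rcons wsz ltnS => im; rewrite !nth_rcons wsz.
    by case: ltnP => [/ws//|?]; case: eqP.
  have := thin_hat tF Fs Fsm (prefix_rcons _ _) => /(congr1 (@size nat)).
  by rewrite size_rcons; lia.
elim: p => [_|p IH pw].
  rewrite take0; have [F0'|nF0] := pselect (F [::]); last by right.
  by left; exists [::] => //; rewrite prefix0s.
have [|[Fp nFp]] := IH (ltnW pw); first by left.
have Fp' : hat F (take p.+1 w).
  rewrite (take_nth 0%N)//; apply: step => //; rewrite -take_nth//; last exact: finsub_take.
  by move=> j /= /mem_take/wL.
have [Fp1|nFp1] := pselect (F (take p.+1 w)); last by right.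
by left; exists (take p.+1 w) => //; exact: prefix_take.
Qed.

(** * Plegma families *)

Lemma plegma_head_le m (S : 'I_m.+1 -> seq nat) j n : plegma S -> n \in S j ->
  (nth 0%N (S ord0) 0 <= n)%N.
Proof.
move=> [S0 Slt _] /mem_nthN[p pj <-].
have size0 i : (0 < size (S i))%N by rewrite lt0n size_eq0 (S0 i).2.
have h0 : (nth 0%N (S ord0) 0 <= nth 0%N (S j) 0)%N.
  have [->//|j0] := eqVneq j ord0.
  by apply/ltnW/Slt => //; rewrite lt0n.
apply: leq_trans h0 _; case: p pj => // p pj.
by apply/ltnW/finsub_nth => //; apply: (S0 j).1.
Qed.

Lemma plegma_take k m (S : 'I_m -> seq nat) : (0 < k)%N -> plegma S ->
  plegma (fun j => take k (S j)).
Proof.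
move=> k0 [S0 S1 S2]; split=> [j|i j p ij|i j p]; rewrite ?size_take_min ?leq_min.
- have [fS Sn] := S0 j; split; first exact: finsub_take.
  by rewrite -size_eq0 size_take_min -lt0n leq_min k0 lt0n size_eq0.
- by move=> /andP[pk pi] /andP[_ pj]; rewrite !nth_take//; apply: S1.
- by move=> /andP[pk pi] /andP[pk' pj]; rewrite !nth_take//; apply: S2.
Qed.

Lemma plegma_drop k m (S : 'I_m -> seq nat) : (forall j, (k < size (S j))%N) -> plegma S ->
  plegma (fun j => drop k (S j)).
Proof.
move=> kS [S0 S1 S2]; split=> [j|i j p ij|i j p]; rewrite ?size_drop.
- have [fS Sn] := S0 j; split; first exact: finsub_drop.
  by rewrite -size_eq0 size_drop -lt0n subn_gt0.
- by move=> pi pj; rewrite !nth_drop; apply: S1 => //; lia.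
- by move=> pi pj; rewrite !nth_drop addnS; apply: S2 => //; lia.
Qed.

Lemma plegma_pair_of m (S : 'I_m -> seq nat) (i j : 'I_m) : plegma S -> (i < j)%N ->
  plegma_pair (S i) (S j).
Proof.
move=> [S0 S1 S2] ij; split.
- by move=> p; case: ifP.
- move=> p q r pq; have -> : p == ord0 by apply/eqP/val_inj => /=; have := ltn_ord q; lia.
  rewrite ifN; first exact: S1.
  by apply/eqP => q0; move: pq; rewrite q0.
- by move=> p q r; case: ifP; case: ifP => _ _; apply: S2.
Qed.

Lemma prefix_nth_map (f : nat -> nat) (u s : seq nat) p : prefix u (map f s) -> (p < size u)%N ->
  (p < size s)%N /\ nth 0%N u p = f (nth 0%N s p).
Proof.
move=> /prefix_nat[r sE] pu.
have ps : (p < size s)%N by rewrite -(size_map f) sE size_cat; lia.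
by split=> //; rewrite -(nth_map 0%N 0%N)// sE nth_cat pu.
Qed.

(* [pre n] is the predecessor of [n] in [L], and [Phi s i] is the initial segment in [F] of
   the set obtained by moving each [n] in [s] to the [i]-th place of a block of a subset of
   [M] that starts at position [gamma (pre n)]. *)
Lemma plegma_copies F M L0 (Q gamma : nat -> nat) :
  regular_thin F -> hat F [::] -> (exists n0, forall n, (n0 <= n)%N -> hat F [:: n]) ->
  infsub M -> infsub L0 -> {homo Q : m n / (m <= n)%N} -> (forall n, n <= gamma n)%N ->
  exists (L pre : nat -> nat) (Phi : seq nat -> nat -> seq nat),
  [/\ infsub L, range L `<=` range L0,
      forall p r, (p < r)%N -> (L p <= pre (L r))%N &
  forall (m N : nat) (S : 'I_m.+1 -> seq nat) (sigma : nat -> 'I_m.+1),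
    let q := pre (nth 0%N (S ord0) 0) in
    plegma S -> (forall j, F (S j)) -> (forall j n, n \in S j -> exists p, n = L p.+1) ->
    {homo sigma : i j / (i <= j)%N} -> (N <= Q q)%N ->
    let T (i : 'I_N.+1) := Phi (S (sigma i)) i in
    [/\ plegma T, forall i, restr F M (T i) & (M (gamma q) <= nth 0%N (T ord0) 0)%N] ].
Proof.
move=> rF F0 F1 iM iL0 Qhomo gamma_le.
have [_ tF [fF _ _ _]] := rF.
have [M' [iM' M'M step]] := hat_step rF iM.
(* The block for [L p.+1] occupies positions [gamma (L p)] to [gamma (L p) + Q (L p)] of [M']; this
   growth makes it end no later than [L p.+1]. *)
have [L [iL LL0 _ LB]] := infsub_thin (fun n => M' (gamma n + Q n)%N) iL0.
have Llt p r : (L p < L r)%N = (p < r)%N.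
  apply/idP/idP; last exact: iL.2.
  by apply: contraTT; rewrite -!leqNgt; apply: infsub_le.
have Lle p r : (L p <= L r)%N = (p <= r)%N by rewrite leqNgt Llt -leqNgt.
have /choice[pre preP] : forall n, exists r, forall p, n = L p.+1 -> r = L p.
  move=> n; have [[p ->]|H] := pselect (exists p, n = L p.+1); last first.
    by exists 0%N => p nE; exfalso; apply: H; exists p.
  exists (L p) => r /eqP; rewrite eqn_leq !Lle => /andP[pr rp].
  by congr L; lia.
have preE p : pre (L p.+1) = L p by exact: preP.
pose phi i n := M' (gamma (pre n) + i)%N.
have phi_le p i : (i <= Q (L p))%N -> (phi i (L p.+1) <= L p.+1)%N.
  move=> iQ; apply: leq_trans (LB p); rewrite /phi preE.
  by apply: infsub_le => //; lia.
(* A block starts strictly above the predecessor of its element, because [gamma] does not decrease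
   its argument and [M'] exceeds its index. So distinct blocks do not interlace. *)
have phi_lt p r i j : (p < r)%N -> (i <= Q (L p))%N -> (phi i (L p.+1) < phi j (L r.+1))%N.
  move=> pr iQ; apply: leq_ltn_trans (phi_le _ _ iQ) _.
  rewrite /phi preE; apply: leq_ltn_trans (infsub_gt _ iM').
  by apply: leq_trans (leq_addr _ _); apply: leq_trans (gamma_le _); rewrite Lle.
have phi_lti n i j : (i < j)%N -> (phi i n < phi j n)%N.
  by move=> ij; apply: iM'.2; lia.
(* The value is meaningful only when some initial segment is in [F]; [prefix_below] guarantees this
   for the copies used. *)
have /choice[Phi' PhiP] : forall si : seq nat * nat, exists u,
    (exists2 u, F u & prefix u (map (phi si.2) si.1)) ->
    F u /\ prefix u (map (phi si.2) si.1).
  move=> si; have [[u Fu us]|H] := pselect (exists2 u, F u & prefix u (map (phi si.2) si.1)).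
    by exists u.
  by exists [::] => /H.
exists L, pre, (fun s i => Phi' (s, i)); split=> //.
  move=> p [//|r] pr; by rewrite preE Lle.
move=> m N S sigma q plS FS LS shomo NQ T.
have [S0 S1 S2] := plS.
have S0n : (0 < size (S ord0))%N by rewrite lt0n size_eq0 (S0 _).2.
have [p0 p0E] := LS ord0 _ (mem_nth 0%N S0n).
have qE : q = L p0 by rewrite /q p0E preE.
have Sge j n : n \in S j -> exists2 p, n = L p.+1 & (p0 <= p)%N.
  move=> nS; have [p nE] := LS j n nS; exists p => //.
  by have := plegma_head_le plS nS; rewrite p0E nE Lle.
have iQ (i : 'I_N.+1) p : (p0 <= p)%N -> (i <= Q (L p))%N.
  move=> p0p; apply: leq_trans (Qhomo (L p0) (L p) _); last by rewrite Lle.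
  by rewrite -qE; apply: leq_trans NQ; rewrite -ltnS.
have TP (i : 'I_N.+1) : F (T i) /\ prefix (T i) (map (phi i) (S (sigma i))).
  apply: (PhiP (S (sigma i), nat_of_ord i)) => /=.
  have fS := (S0 (sigma i)).1.
  have SL p : (p < size (S (sigma i)))%N ->
      exists2 r, nth 0%N (S (sigma i)) p = L r.+1 & (p0 <= r)%N.
    by move=> pS; apply: (Sge (sigma i)); apply: mem_nth.
  apply: (prefix_below rF iM' F0 step (FS (sigma i))); rewrite ?size_map//.
  - apply/finsubP; rewrite size_map; split=> p pS; rewrite !(nth_map 0%N)//; try lia.
      exact: leq_ltn_trans (infsub_gt _ iM').
    have [|r rE r0] := SL p; first by lia.
    have [r' r'E r'0] := SL p.+1 pS.
    have := finsub_nth fS (ltnSn p) pS; rewrite rE r'E Llt ltnS => rr'.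
    by apply: phi_lt => //; apply: iQ.
  - by move=> n /mapP[n' _ ->]; exists (gamma (pre n') + i)%N.
  - move=> p pS; rewrite (nth_map 0%N)//; have [r -> r0] := SL p pS.
    by apply: phi_le; apply: iQ.
have Tn (i : 'I_N.+1) p : (p < size (T i))%N ->
    exists r, [/\ (p < size (S (sigma i)))%N, nth 0%N (S (sigma i)) p = L r.+1,
      (p0 <= r)%N & nth 0%N (T i) p = phi i (L r.+1)].
  move=> pT; have [pS ->] := prefix_nth_map (TP i).2 pT.
  by have [r rE r0] := Sge _ _ (mem_nth 0%N pS); exists r; rewrite rE.
(* An empty member of the thin family [F] would exclude the singletons from its tree. *)
have T0 i : T i != [::].
  apply/eqP => Ti; have [n0 /(_ n0 (leqnn _)) Fn] := F1.
  have [FT _] := TP i; rewrite Ti in FT.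
  by have := thin_hat tF FT Fn (prefix0s _).
have MM' := range_sub_le _ iM iM' M'M.
split.
- split=> [i|i j p ij /Tn[r [rS rE r0 ->]] /Tn[r' [r'S r'E r'0 ->]]
            |i j p /Tn[r [rS rE r0 ->]] /Tn[r' [r'S r'E r'0 ->]]].
  + by split=> //; apply: fF; apply: hatW; case: (TP i).
  (* Copies of one set are ordered by their places within each block; copies of different sets
     inherit the order of the original plegma tuple. *)
  + have : (sigma i <= sigma j)%N by apply: shomo; apply: ltnW.
    rewrite leq_eqVlt => /predU1P[/val_inj sE|sij].
      have -> : r' = r.
        by move: r'E; rewrite -sE rE => /eqP; rewrite eqn_leq !Lle; lia.
      exact: phi_lti.
    have := S1 _ _ _ sij rS r'S; rewrite rE r'E Llt ltnS => rr'.
    by apply: phi_lt => //; apply: iQ.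
  + have := S2 _ _ _ rS r'S; rewrite rE r'E Llt ltnS => rr'.
    by apply: phi_lt => //; apply: iQ.
- move=> i; have [FT /prefix_nat[u uE]] := TP i; split=> // n /= nT; apply: M'M.
  have : n \in map (phi i) (S (sigma i)) by rewrite uE mem_cat nT.
  by move=> /mapP[n' _ ->]; exists (gamma (pre n') + i)%N.
- have [|r [_ _ r0 ->]] := Tn ord0 0%N; first by rewrite lt0n size_eq0.
  apply: leq_trans (MM' _) _; rewrite qE -[gamma _]addn0 -preE -/(phi 0%N (L p0.+1)).
  move: r0; rewrite leq_eqVlt => /predU1P[->//|/phi_lt p0r].
  exact/ltnW/p0r.
Qed.

(** * Spreading models *)

Lemma sum_ord_widen0 (V : nmodType) (f : nat -> V) N n : (N <= n)%N ->
  (forall i, (N <= i)%N -> f i = 0) -> \sum_(i < n) f i = \sum_(i < N) f i.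
Proof.
move=> Nn f0; rewrite (big_ord_widen _ _ Nn) [LHS](bigID (fun i : 'I_n => (i < N)%N)) /=.
by rewrite [X in _ + X]big1 ?addr0// => i; rewrite -leqNgt => /f0.
Qed.

Lemma finite_expansion (R : realType) (E : normedModType R) (b : nat -> E) (x : E) :
  schauder_basis b -> finite_set (supp b x) ->
  exists (a : nat -> R) (N : nat), [/\ forall i, (N <= i)%N -> a i = 0,
    forall i, a i != 0 -> supp b x i & x = \sum_(i < N) a i *: b i].
Proof.
move=> bb fs; have [a [ax _]] := bb x.
have as_ i : a i != 0 -> supp b x i by exists a.
have [N NP] : exists N, forall i, supp b x i -> (i < N)%N.
  have /finite_seqP[s sE] := fs.
  exists (\max_(i <- s) i).+1 => i; rewrite sE ltnS => /= i_s.
  exact: (@leq_bigmax_seq _ _ xpredT id).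
have aN i : (N <= i)%N -> a i = 0.
  by move=> Ni; apply/eqP; apply: contraTT Ni => /as_/NP; rewrite ltnNge.
exists a, N; split=> //.
have H : series (fun n => a n *: b n) @ \oo --> \sum_(i < N) a i *: b i.
  apply: cvg_near_cst; exists N => // n /= Nn.
  rewrite seriesEord /= (sum_ord_widen0 (f := fun i => a i *: b i) Nn)// => i /aN ->.
  by rewrite scale0r.
exact: (cvg_unique _ ax H).
Qed.

(** By homogeneity: dividing the coefficients by [K] brings them into [[-1, 1]]. *)
Lemma generates_scaled (R : realType) (X : normedModType R) (e : seminormed_basis R)
    (x : seq nat -> X) m (S : 'I_m.+1 -> seq nat) (a : 'I_m.+1 -> R) (K d : R) :
  0 < K -> (forall j, `|a j| <= K) ->
  (forall a : 'I_m.+1 -> R, (forall j, -1 <= a j <= 1) ->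
     `| `|\sum_j a j *: x (S j)| - sb_norm (\sum_j a j *: sb_seq e j) | <= d) ->
  `| `|\sum_j a j *: x (S j)| - sb_norm (\sum_j a j *: sb_seq e j) | <= K * d.
Proof.
move=> K0 aK H.
have -> : \sum_j a j *: x (S j) = K *: \sum_j (a j / K) *: x (S j).
  rewrite scaler_sumr; apply: eq_bigr => j _.
  by rewrite scalerA mulrC divfK// gt_eqF.
have -> : \sum_j a j *: sb_seq e j = K *: \sum_j (a j / K) *: sb_seq e j.
  rewrite scaler_sumr; apply: eq_bigr => j _.
  by rewrite scalerA mulrC divfK// gt_eqF.
rewrite normrZ sb_normZ (gtr0_norm K0) -mulrBr normrM (gtr0_norm K0) ler_pM2l//.
apply: H => j; rewrite -ler_norml normrM normfV (gtr0_norm K0).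
by rewrite ler_pdivrMr ?mul1r.
Qed.

Lemma regroup (R : realType) (V : lmodType R) m N (c : 'I_m -> R) (a : 'I_m -> nat -> R)
    (w : 'I_m -> nat -> V) (sigma : nat -> 'I_m) :
  (forall j i, a j i != 0 -> sigma i = j) ->
  \sum_j c j *: (\sum_(i < N) a j i *: w j i) =
  \sum_(i < N) (c (sigma i) * a (sigma i) i) *: w (sigma i) i.
Proof.
move=> aS; under eq_bigr => j _ do rewrite scaler_sumr.
rewrite exchange_big /=; apply: eq_bigr => i _.
rewrite (bigD1 (sigma i))//= big1 ?addr0 ?scalerA// => j ji.
have [->|/aS sE] := eqVneq (a j i) 0; first by rewrite scale0r scaler0.
by rewrite sE eqxx in ji.
Qed.

(** [sigma i] is the last [j] whose block has begun by [i], and 0 if none has. This extends the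
    assignment monotonically over the gaps between the blocks. *)
Lemma monotone_selection m (P : 'I_m.+1 -> nat -> Prop) :
  (forall i j : 'I_m.+1, (i < j)%N -> forall p q, P i p -> P j q -> (p < q)%N) ->
  exists sigma : nat -> 'I_m.+1, {homo sigma : i j / (i <= j)%N} /\
    forall j i, P j i -> sigma i = j.
Proof.
move=> Pblock.
pose A i (j : 'I_m.+1) := `[< exists2 p, (p <= i)%N & P j p >].
pose s i := \max_(j | A i j) nat_of_ord j.
have sm i : (s i < m.+1)%N.
  by rewrite ltnS; apply/bigmax_leqP => j _; rewrite -ltnS.
exists (fun i => Ordinal (sm i)); split=> [i j ij|j i Pji] /=.
  apply/bigmax_leqP => r /asboolP[p pi Pp].
  apply: (@leq_bigmax_cond _ (A j) (fun r : 'I_m.+1 => nat_of_ord r)).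
  by apply/asboolP; exists p => //; apply: leq_trans ij.
apply/val_inj/eqP; rewrite /= eqn_leq; apply/andP; split.
  apply/bigmax_leqP => r /asboolP[p pi Pp]; rewrite leqNgt; apply/negP => jr.
  by have := Pblock _ _ jr _ _ Pji Pp; rewrite ltnNge pi.
apply: (@leq_bigmax_cond _ (A i) (fun r : 'I_m.+1 => nat_of_ord r)).
by apply/asboolP; exists i.
Qed.

Lemma restr_prepend_tail (F G : set (seq nat)) k n0 (L0 L L' : nat -> nat) v :
  (forall t, finsub t -> size t = k -> {in t, forall n, (n0 <= n)%N} -> G t) ->
  (forall p, L0 p = L (n0 + p)%N) -> infsub L -> range L' `<=` range L0 ->
  restr (prepend k F) L' v -> restr G L (take k v).
Proof.
move=> Gtail L0E iL L'L [[fv kv _] vL'].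
have vL n : n \in take k v -> exists p, n = L (n0 + p)%N.
  by move=> /mem_take/vL'/L'L[p _ <-]; exists p.
split; last by move=> n /vL[p ->]; exists (n0 + p)%N.
apply: Gtail; [exact: finsub_take|exact: size_takel|].
by move=> n /vL[p ->]; have := infsub_gt (n0 + p) iL; lia.
Qed.

Lemma tail_index (R : realType) (delta : nat -> R) (K : nat -> nat) (Q : nat -> nat) :
  delta @ \oo --> (0 : R) ->
  exists gamma : nat -> nat, forall q, [/\ (q <= gamma q)%N, (Q q <= gamma q)%N &
    (K q).+1%:R * delta (gamma q) <= q.+1%:R^-1].
Proof.
move=> dc; suff H q : exists g, [/\ (q <= g)%N, (Q q <= g)%N & (K q).+1%:R * delta g <= q.+1%:R^-1].
  by have [gamma gP] := choice H; exists gamma.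
have c0 : 0 < (q.+1%:R^-1 / (K q).+1%:R : R) by rewrite divr_gt0// invr_gt0.
have /cvgrPdist_le/(_ _ c0)[N _ NP] := dc.
exists (maxn N (maxn q (Q q))); split; try lia.
have := NP (maxn N (maxn q (Q q))) (leq_maxl _ _).
rewrite sub0r normrN => /(le_trans (ler_norm _)).
by rewrite ler_pdivlMr// mulrC.
Qed.

Lemma coefficient_bound (R : realType) (a : nat -> R) N : (forall i, (N <= i)%N -> a i = 0) ->
  exists K : nat, forall i, `|a i| <= K%:R.
Proof.
move=> aN; exists (Num.bound (\sum_(i < N) `|a i|)) => i.
have s0 : 0 <= \sum_(i < N) `|a i| by apply: sumr_ge0.
apply: le_trans (ltW (archi_boundP s0)).
have [Ni|iN] := leqP N i; first by rewrite aN// normr0.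
by rewrite (bigD1 (Ordinal iN))//= lerDl sumr_ge0.
Qed.

(** * Transfer of the spreading model from [E] to [X] *)

Theorem theorem0p19 (R : realType) (X : completeNormedModType R)
    (xi : cord) (hxi : ole (onat 1) xi)
    (e : seminormed_basis R) (he : SM xi X e)
    (E : completeNormedModType R) (iota : {linear sb_space e -> E})
    (hE : generated_space iota)
    (hbasic : schauder_basis (fun n => iota (sb_seq e n)))
    (k : nat) (hk : (0 < k)%N)
    (ebar : seminormed_basis R)
    (hebar : plegma_block_SM (onat k) (fun n => iota (sb_seq e n)) ebar) :
  SM (oaddn xi k) X ebar.
Proof.
have [F [M [x [rF oF iM [delta [delta0 delta_c x_e]]]]]] := he.
have [G [L [y [rG oG iL [y_fin y_block] [eps [eps0 eps_c y_ebar]]]]]] := hebar.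
have [_ iotaN _] := hE.
have [_ tF _] := rF.
have F0 : hat F [::] := oF.1.
have F1 := singletons_hat rF oF hxi.
have [n0 Gtail] := finite_order_tail hk rG oG.
have /choice[aN aNP] : forall t, exists aN : (nat -> R) * nat, restr G L t ->
    [/\ forall i, (aN.2 <= i)%N -> aN.1 i = 0,
      forall i, aN.1 i != 0 -> supp (fun n => iota (sb_seq e n)) (y t) i &
      y t = \sum_(i < aN.2) aN.1 i *: iota (sb_seq e i)].
  move=> t; have [Gt|nGt] := pselect (restr G L t); last by exists (fun=> 0, 0%N).
  by have [a [N aP]] := finite_expansion hbasic (y_fin t Gt); exists (a, N).
pose a t := (aN t).1; pose Nt t := (aN t).2.
have /choice[K KP] : forall t, exists K : nat, restr G L t -> forall i, `|a t i| <= K%:R.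
  move=> t; have [Gt|nGt] := pselect (restr G L t); last by exists 0%N.
  by have [a0 _ _] := aNP t Gt; have [K KP] := coefficient_bound a0; exists K.
(* One number [q] will bound all elements of all the [t j], so [Q q] and [KB q] control supports and
   coefficients uniformly over a plegma tuple. *)
have [Q [Qhomo QP]] := finsub_bound Nt.
have [KB [_ KBP]] := finsub_bound K.
have [gamma gammaP] := tail_index KB Q delta_c.
(* Skipping [n0] terms puts all elements above [n0], where every [k]-set is in [G]. *)
pose L0 p := L (n0 + p)%N.
have iL0 : infsub L0.
  split=> [|p r pr]; last by apply: iL.2; lia.
  exact: leq_ltn_trans (infsub_gt _ iL).
have gamma_le q : (q <= gamma q)%N by case: (gammaP q).
have [L' [pre [Phi [iL' L'L0 pre_le copies]]]] := plegma_copies rF F0 F1 iM iL0 Qhomo gamma_le.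
have L'L : range L' `<=` range L by move=> p /L'L0[r _ <-]; exists (n0 + r)%N.
pose z v := \sum_(i < Nt (take k v)) a (take k v) i *: x (Phi (drop k v) i).
exists (prepend k F), L', z; split=> //; first exact: regular_thin_prepend.
  exact: has_order_prepend.
(* The term [eps l] pays for passing from [ebar] to [E], and the reciprocal for passing from [E] to
   [X]. *)
exists (fun l => eps l + l.+1%:R^-1); split=> [l||m l V c ml plV HV lV cP].
- by rewrite addr_gt0// invr_gt0.
- rewrite -[0]addr0; apply: cvgD => //; exact: cvg_harmonic.
pose t j := take k (V j); pose s j := drop k (V j).
have Gt j : restr G L (t j) by exact: restr_prepend_tail Gtail (fun=> erefl) iL L'L0 (HV j).
have Fs j : F (s j) by case: (HV j) => -[].
have fV j : finsub (V j) by case: (HV j) => -[].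
have kV j : (k < size (V j))%N.
  have [[_ kV _] _] := HV j; rewrite ltn_neqAle kV andbT; apply/eqP => kE.
  have [n1 /(_ _ (leqnn _)) Fn] := F1; have := Fs j; rewrite /s kE drop_size => Fnil.
  by have := thin_hat tF Fnil Fn (prefix0s _).
have plt : plegma t by exact: plegma_take.
have pls : plegma s by exact: plegma_drop.
pose q := pre (nth 0%N (s ord0) 0).
have VL' j n : n \in V j -> exists p, n = L' p by move=> /((HV j).2)[p _ <-]; exists p.
(* By the plegma condition the [k]-th element of any [V j] is below the next element of [V ord0],
   which is the first of [s ord0]; and [q] is the predecessor of the latter in [L']. *)
have tq j n : n \in t j -> (n <= q)%N.
  move=> nt; have [p nE] := VL' j n (mem_take nt).
  have [|r rE] := VL' ord0 (nth 0%N (s ord0) 0).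
    by rewrite nth_drop addn0 mem_nth.
  rewrite /q rE nE; apply: pre_le; rewrite ltnNge; apply/negP => /(infsub_le iL').
  rewrite -nE -rE leqNgt => /negP; apply.
  have [i ik <-] := mem_nthN nt; move: ik; rewrite size_takel ?(ltnW (kV j))// => ik.
  rewrite nth_take// nth_drop addn0; have [_ _ pl2] := plV.
  have := pl2 j ord0 k.-1; rewrite prednK//.
  move=> /(_ (ltnW (kV _)) (kV _)); apply: leq_ltn_trans.
  have [->//|ne] := eqVneq i k.-1.
  by apply/ltnW/finsub_nth => //; [lia|apply: leq_ltn_trans (leq_pred _) (kV _)].
(* The first element of [L'] has no predecessor; it cannot occur in [s j], since [t j] is nonempty
   and lies below [s j]. *)
have sL' j n : n \in s j -> exists p, n = L' p.+1.
  move=> ns; have [[|p] nE] := VL' j n (mem_drop ns); last by exists p.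
  have nt : nth 0%N (V j) 0 \in t j.
    by rewrite -(nth_take 0%N hk) mem_nth// size_takel// ltnW.
  have [p pE] := VL' j _ (mem_take nt).
  have := @finsub_catP (take k (V j)) (drop k (V j)); rewrite cat_take_drop => /(_ (fV j) _ _ nt ns).
  by rewrite pE nE ltnNge (infsub_le iL').
have block (i j : 'I_m.+1) : (i < j)%N -> forall p r, a (t i) p != 0 -> a (t j) r != 0 -> (p < r)%N.
  move=> ij p r ap ar; have [_ supi _] := aNP _ (Gt i); have [_ supj _] := aNP _ (Gt j).
  apply: (y_block (t i) (t j)) => //; [exact: plegma_pair_of|exact: supi|exact: supj].
have [sigma [shomo sigmaP]] := monotone_selection block.
have sigmaP' j i : a (t j) i != 0 -> sigma i = j by exact: sigmaP.
have [plT rT T0] := copies m (Q q) s sigma pls Fs sL' shomo (leqnn _).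
set T := (fun i : 'I_(Q q).+1 => _) in plT rT T0.
have ft j : finsub (t j) by exact: finsub_take.
have NtQ j : (Nt (t j) <= (Q q).+1)%N by apply: leqW; apply: QP (ft j) (tq j).
have zE j : z (V j) = \sum_(i < (Q q).+1) a (t j) i *: x (Phi (s j) i).
  have [a0 _ _] := aNP _ (Gt j); apply/esym.
  apply: (sum_ord_widen0 (f := fun i => a (t j) i *: x (Phi (s j) i)) (NtQ j)) => i /a0.
  by rewrite /a => ->; rewrite scale0r.
have yE j : y (t j) = iota (\sum_(i < (Q q).+1) a (t j) i *: sb_seq e i).
  have [a0 _ ->] := aNP _ (Gt j); rewrite linear_sum.
  under [RHS]eq_bigr => i _ do rewrite linearZ.
  apply/esym/(sum_ord_widen0 (f := fun i => a (t j) i *: iota (sb_seq e i)) (NtQ j)) => i /a0.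
  by rewrite /a => ->; rewrite scale0r.
pose d (i : 'I_(Q q).+1) := c (sigma i) * a (t (sigma i)) i.
have zsum : \sum_j c j *: z (V j) = \sum_i d i *: x (T i).
  under eq_bigr => j _ do rewrite zE.
  exact: (@regroup _ _ _ (Q q).+1 c (fun j => a (t j)) (fun j i => x (Phi (s j) i))).
have ysum : \sum_j c j *: y (t j) = iota (\sum_i d i *: sb_seq e i).
  rewrite -(@regroup _ _ _ (Q q).+1 c (fun j => a (t j)) (fun j i => sb_seq e i))//.
  by rewrite linear_sum; apply: eq_bigr => j _; rewrite linearZ yE.
(* The successor keeps the scaling factor positive. *)
have dK i : `|d i| <= (KB q).+1%:R.
  rewrite normrM -[leRHS]mul1r ler_pM//; first by rewrite ler_norml.
  apply: le_trans (KP _ (Gt _) _) _; rewrite ler_nat leqW//.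
  exact: KBP (ft _) (tq _).
have [_ Qg Kd] := gammaP q.
have est := generates_scaled (ltr0Sn R (KB q)) dK
  (fun b bP => x_e (Q q) (gamma q) T b Qg plT rT T0 bP).
have lq : (l <= q)%N.
  apply: leq_trans (tq ord0 (nth 0%N (V ord0) 0) _).
    by apply: leq_trans lV; apply/ltnW/infsub_gt.
  by rewrite -(nth_take 0%N hk) mem_nth// size_takel// ltnW.
have L_t : (L l <= nth 0%N (t ord0) 0)%N.
  by rewrite nth_take//; apply: leq_trans lV; apply: range_sub_le.
have := y_ebar m l t c ml plt Gt L_t cP; rewrite ysum iotaN => est'.
(* The middle term is the norm of the regrouped sum of the [e_i], equal to that of the sum in [E]
   because [iota] is isometric. The first error is at most the reciprocal of [q.+1], and
   [l <= q]. *)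
rewrite zsum [leRHS]addrC; apply: le_trans (ler_distD (sb_norm (\sum_i d i *: sb_seq e i)) _ _) _.
apply: lerD => //; apply: (le_trans est); apply: (le_trans Kd).
by rewrite lef_pV2 ?posrE// ler_nat.
Qed.
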